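(* Let $k\ge 1$ be an integer and let $c^k(n,\ell)$ be the number of $k$-compositions of $n$ with exactly $\ell$ parts, where zeros are counted as parts. Then for all $n\ge 2$ and $\ell\ge 1$, $$c^k(n,\ell)=c^k(n-1,\ell-k)+\cdots+c^k(n-1,\ell-1)+c^k(n-1,\ell),$$ that is, $c^k(n,\ell)=\sum_{j=0}^{k}c^k(n-1,\ell-j)$; and for all $n\ge 1$ and $\ell\ge 1$, $$c^k(n,\ell)=\binom{n-1}{\ell-1}_k .$$
   Context: For positive integers $k$ and $n$, a $k$-composition of $n$ (internal-zeros form) is an ordered sequence of positive integers with sum $n$ in which, in addition, each positive part except the first may be immediately preceded by up to $k-1$ zeros. Equivalently, it is a finite sequence of nonnegative integers with sum $n$ whose first and last entries are positive and with at most $k-1$ zeros between any two successive positive entries. All entries, zero or positive, are called parts. Put $c^k(n,\ell)=0$ when $\ell\le 0$. The multinomial (polynomial) coefficient is $\binom{n}{\ell}_k=[x^\ell](1+x+\cdots+x^k)^n$, the coefficient of $x^\ell$ in that polynomial. *)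

(* Defs.v *)
From mathcomp Require Import all_boot all_order all_algebra.

Set Implicit Arguments.
Unset Strict Implicit.
Unset Printing Implicit Defensive.

(* i < j are the positions of two successive positive entries of s. *)
Definition successive_pos (s : seq nat) (i j : nat) : bool :=
  [&& i < j, 0 < nth 0 s i, 0 < nth 0 s j &
      all (fun m => nth 0 s m == 0) (iota i.+1 (j - i.+1))].

(* The default value 0 of head and last rejects the empty sequence. The
   entries strictly between positions i < j number j - i - 1. *)
Definition is_kcomposition (k n : nat) (s : seq nat) : bool :=
  [&& sumn s == n, 0 < head 0 s, 0 < last 0 s &
      [forall i : 'I_(size s), forall j : 'I_(size s),
         successive_pos s i j ==> (j - i - 1 <= k - 1)]].

(* Entries of a k-composition of n are at most n, so ranging over tuples with
   entries in {0, ..., n} loses nothing. *)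
Lemma kcomposition_bound (k n : nat) (s : seq nat) :
  is_kcomposition k n s -> all (fun x => x < n.+1) s.
Proof.
case/and4P=> /eqP <- _ _ _; apply/allP => x.
elim: s => //= y s IH; rewrite inE ltnS => /orP[/eqP -> | /IH xs].
  exact: leq_addr.
by rewrite (leq_trans (ltnSE xs)) // leq_addl.
Qed.

(* The number of parts is an integer, with value 0 for l <= 0. *)
Definition num_kcompositions (k n : nat) (l : int) : nat :=
  if l is Posz m.+1 then
    #|[set t : m.+1.-tuple 'I_n.+1 | is_kcomposition k n (map val t)]|
  else 0.

Definition polynomial_coef (k n l : nat) : int :=
  (((\sum_(i < k.+1) 'X^i : {poly int}) ^+ n)`_l)%R.

(* Main.v *)
Require Import Defs.
From mathcomp Require Import all_boot all_order all_algebra.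
From mathcomp Require Import zify.
Import GRing.Theory.

Local Open Scope ring_scope.

(** Look at the first part [x] of a k-composition of [n >= 2]. If [x >= 2],
    replacing [x] by [x - 1] gives an arbitrary k-composition of [n - 1] with
    the same number of parts. If [x = 1], the composition goes on with [j < k]
    zeros followed by an arbitrary k-composition of [n - 1], which has [j + 1]
    parts fewer. Summing over these [k + 1] cases gives the recurrence.

    This decomposition is turned into a duplicate-free enumeration [kcomps] of
    all k-compositions, produced by the two inverse operations; [mem_kcomps]
    and [kcomps_uniq] say that it is exact, so that counting its members of a
    given length gives the recurrence ([num_kcompositionsS]).

    Multiplication by [1 + X + ... + X^k] acts on coefficients by the very same
    recurrence, and at [n = 1] both sides are 1 at length 1 and 0 elsewhere, so
    the closed form follows by induction on [n]. *)

Section KCompositions.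

Local Open Scope nat_scope.

(** * Bounded runs of zeros *)

Definition bounded_gaps (k : nat) (s : seq nat) : Prop :=
  forall i j, successive_pos s i j -> j - i <= k.

Lemma successive_posP (s : seq nat) (i j : nat) :
  reflect [/\ i < j, 0 < nth 0 s i, 0 < nth 0 s j
            & forall m, i < m < j -> nth 0 s m = 0]
          (successive_pos s i j).
Proof.
apply: (iffP and4P) => -[ij si sj szero]; split=> //.
  move=> m /andP[im mj]; apply/eqP.
  by apply: (allP szero); rewrite mem_iota im /= subnKC.
apply/allP => m; rewrite mem_iota subnKC // => im.
by rewrite szero.
Qed.

(** Positions outside [s] read as 0, so the quantification over the positions
    of [s] may be extended to all natural numbers. The bound [k - 1] on the
    number of zeros becomes the bound [k] on the distance, as [0 < k]. *)
Lemma is_kcompositionP (k n : nat) (s : seq nat) : 0 < k ->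
  reflect [/\ sumn s = n, 0 < head 0 s, 0 < last 0 s & bounded_gaps k s]
          (is_kcomposition k n s).
Proof.
move=> k_gt0; apply: (iffP and4P) => -[sum_s hd_s last_s gaps]; split=> //.
- exact/eqP.
- move=> i j sij; have [ij si sj _] := successive_posP _ _ _ sij.
  have lt_size m : 0 < nth 0 s m -> m < size s.
    by apply: contraTT; rewrite -leqNgt => /(nth_default 0) ->.
  have /forallP/(_ (Ordinal (lt_size _ si))) := gaps.
  by move/forallP/(_ (Ordinal (lt_size _ sj)))/implyP/(_ sij) => /=; lia.
- exact/eqP.
apply/forallP => i; apply/forallP => j; apply/implyP => /gaps; lia.
Qed.

Lemma bounded_gaps_incr (k x : nat) (s : seq nat) :
  bounded_gaps k (x.+2 :: s) <-> bounded_gaps k (x.+1 :: s).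
Proof.
by split=> gaps i j /successive_posP[ij si sj sz];
  apply: gaps; apply/successive_posP; split=> //;
  [case: i si {ij sz} | case: j sj {ij sz}
  | case=> // m /sz
  | case: i si {ij sz} | case: j sj {ij sz}
  | case=> // m /sz].
Qed.

(** The new leading 1 forms exactly one new pair of successive positive
    entries, with the head of [t]; all other pairs are those of [t], shifted. *)
Lemma bounded_gaps_block (k j : nat) (t : seq nat) : 0 < head 0 t ->
  bounded_gaps k (1 :: nseq j 0 ++ t) <-> j < k /\ bounded_gaps k t.
Proof.
move=> hd_t; set s := 1 :: _.
have s_zero m : 0 < m <= j -> nth 0 s m = 0.
  case: m => //= m mj.
  by rewrite nth_cat size_nseq mj nth_nseq mj.
have s_shift m : nth 0 s (j.+1 + m) = nth 0 t m.
  by rewrite /= nth_cat size_nseq ltnNge leq_addr addKn.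
have sj : 0 < nth 0 s j.+1 by rewrite -[j.+1]addn0 s_shift nth0.
split=> [gaps | [jk gaps] a b /successive_posP[ab sa sb sz]].
  split.
    by rewrite -[j.+1]subn0; apply: gaps; apply/successive_posP; split.
  move=> a b /successive_posP[ab ta tb tz].
  rewrite -(subnDl j.+1); apply: gaps; apply/successive_posP.
  split; rewrite ?s_shift ?ltn_add2l // => m amb.
  by rewrite -(subnKC (_ : j.+1 <= m)) ?s_shift ?tz //; lia.
have [a0 | a_gt0] := posnP a.
  have [|bj] := leqP b j.+1; first by lia.
  by move: sj; rewrite sz // a0 bj.
have [aj | ja] := leqP a j; first by rewrite s_zero ?a_gt0 in sa.
rewrite -(subnKC ja) -(subnKC (ltn_trans ja ab)) subnDl in sa sb *.
rewrite !s_shift in sa sb; apply: gaps; apply/successive_posP.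
split=> // [|m amb]; first by lia.
by rewrite -s_shift sz //; lia.
Qed.

(** * Decomposition by the first part *)

Lemma is_kcomposition_incr (k n x : nat) (s : seq nat) : 0 < k ->
  is_kcomposition k n.+1 (x.+2 :: s) = is_kcomposition k n (x.+1 :: s).
Proof.
move=> k_gt0; apply/is_kcompositionP/is_kcompositionP => // -[] /=.
  move=> [sum_s] _ last_s /bounded_gaps_incr gaps.
  by split=> //; case: s last_s {sum_s gaps}.
move=> sum_s _ last_s /bounded_gaps_incr gaps.
by split=> //=; [rewrite -sum_s | case: s last_s {sum_s gaps}].
Qed.

Lemma is_kcomposition_block (k n j : nat) (t : seq nat) :
  0 < k -> 0 < head 0 t ->
  is_kcomposition k n.+1 (1 :: nseq j 0 ++ t)
    = (j < k) && is_kcomposition k n t.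
Proof.
move=> k_gt0 hd_t.
have sumE : sumn (1 :: nseq j 0 ++ t) = (sumn t).+1.
  by rewrite /= sumn_cat sumn_nseq.
have lastE : last 0 (1 :: nseq j 0 ++ t) = last 0 t.
  by rewrite /= last_cat; case: t hd_t {sumE}.
apply/is_kcompositionP/andP => //.
  rewrite sumE lastE => -[[sum_t] _ last_t] /bounded_gaps_block-/(_ hd_t)[jk gaps].
  by split=> //; apply/is_kcompositionP.
move=> [jk /is_kcompositionP-/(_ k_gt0)[sum_t _ last_t gaps]].
by rewrite sumE lastE sum_t; split=> //; apply/bounded_gaps_block.
Qed.

Lemma leading_zerosP (s : seq nat) : 0 < sumn s ->
  exists j t, s = nseq j 0 ++ t /\ 0 < head 0 t.
Proof.
elim: s => //= -[|x] s IHs s_gt0; last by exists 0, (x.+1 :: s).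
by have [j [t [-> hd_t]]] := IHs s_gt0; exists j.+1, t.
Qed.

(** A first part 1 already exhausts the sum, so anything after it would end in
    a zero. *)
Lemma is_kcomposition1 (k : nat) (s : seq nat) : 0 < k ->
  is_kcomposition k 1 s = (s == [:: 1]).
Proof.
move=> k_gt0; apply/is_kcompositionP/eqP => // [[]|->]; last first.
  by split=> // i j /successive_posP[+ + +]; case: i j => [|[]] [|[]].
case: s => [|[|[|x]] s] //= [sum_s] _ last_s _.
case/lastP: s sum_s last_s => // s y; rewrite sumn_rcons last_rcons; lia.
Qed.

(** * Enumeration of the k-compositions *)

(** Shifted by one, [kcomps k n] being about sum [n.+1]: the decomposition by
    the first part fails for [[:: 1]], the only k-composition of 1, which is
    therefore where the recursion starts. *)
Fixpoint kcomps (k n : nat) : seq (seq nat) :=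
  if n is m.+1 then
    [seq incr_nth s 0 | s <- kcomps k m] ++
    [seq 1 :: nseq j 0 ++ t | j <- iota 0 k, t <- kcomps k m]
  else [:: [:: 1]].

Lemma mem_kcomps (k n : nat) (s : seq nat) : 0 < k ->
  (s \in kcomps k n) = is_kcomposition k n.+1 s.
Proof.
move=> k_gt0; elim: n s => [|n IHn] s /=.
  by rewrite is_kcomposition1 // inE.
rewrite mem_cat; apply/orP/idP.
  case=> [/mapP[t] | /allpairsP[[j t]] /= [+ + ->]].
    rewrite IHn => t_comp ->; case: t t_comp => [|[|x] t] t_comp /=.
    - by case/and4P: t_comp.
    - by case/and4P: t_comp.
    by rewrite is_kcomposition_incr.
  rewrite mem_iota IHn /= add0n => jk t_comp.
  have /and4P[_ hd_t _ _] := t_comp.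
  by rewrite is_kcomposition_block // jk.
case: s => [|[|[|x]] s] s_comp; try by case/and4P: s_comp.
- right; have sum_s : 0 < sumn s by case/and4P: s_comp => /eqP /=; lia.
  have [j [t [eq_s hd_t]]] := leading_zerosP _ sum_s.
  move: s_comp; rewrite eq_s is_kcomposition_block // => /andP[jk t_comp].
  by apply/allpairsP; exists (j, t); rewrite mem_iota IHn.
- left; apply/mapP; exists (x.+1 :: s) => //.
  by rewrite IHn -is_kcomposition_incr.
Qed.

Lemma head_kcomps (k n : nat) (s : seq nat) : 0 < k ->
  s \in kcomps k n -> 0 < head 0 s.
Proof. by move=> k_gt0; rewrite mem_kcomps // => /and4P[]. Qed.

(** The number of leading zeros is the position of the first positive entry. *)
Lemma leading_zeros_inj (j1 j2 : nat) (t1 t2 : seq nat) :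
  0 < head 0 t1 -> 0 < head 0 t2 ->
  nseq j1 0 ++ t1 = nseq j2 0 ++ t2 -> (j1, t1) = (j2, t2).
Proof.
move=> hd1 hd2; elim: j1 j2 => [|j1 IHj] [|j2] //=.
- by move=> ->.
- by move=> eq_t; rewrite eq_t in hd1.
- by move=> eq_t; rewrite -eq_t in hd2.
by case=> /IHj[-> ->].
Qed.

Lemma kcomps_uniq (k n : nat) : 0 < k -> uniq (kcomps k n).
Proof.
move=> k_gt0; elim: n => //= n IHn; rewrite cat_uniq; apply/and3P; split.
- rewrite map_inj_in_uniq // => s t /head_kcomps-/(_ k_gt0) hd_s.
  move=> /head_kcomps-/(_ k_gt0) hd_t.
  by case: s t hd_s hd_t => [|x s] [|y t] //= _ _ [-> ->].
- (* The two families differ in their first part: at least 2, resp. 1. *)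
  apply/hasPn => _ /allpairsP[[j t] /= [_ _ ->]].
  apply/negP => /mapP[[|x s] /head_kcomps-/(_ k_gt0) //= hd_s].
  by case=> x0; rewrite -x0 in hd_s.
apply: allpairs_uniq; rewrite ?iota_uniq // => -[j1 t1] [j2 t2].
move=> /allpairsP[[i1 u1] /= [_ /head_kcomps-/(_ k_gt0) hd1 [-> ->]]].
move=> /allpairsP[[i2 u2] /= [_ /head_kcomps-/(_ k_gt0) hd2 [-> ->]]].
by case; apply: leading_zeros_inj.
Qed.

(** * Counting by the number of parts *)

(** Lists that satisfy [P] have entries below [N], so those of length [l]
    correspond to tuples of ordinals, and [r] lists each of them once. *)
Lemma card_tuple_enum (N l : nat) (P : pred (seq nat)) (r : seq (seq nat)) :
    uniq r -> r =i P -> (forall s, P s -> all (fun x => x < N) s) ->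
  #|[set t : l.-tuple 'I_N | P (map val t)]|
    = count (fun s => size s == l) r.
Proof.
move=> r_uniq r_mem bnd; rewrite cardE -size_filter.
rewrite -(size_map (fun t : l.-tuple 'I_N => map val t)).
apply/perm_size/uniq_perm; rewrite ?filter_uniq //.
  rewrite map_inj_uniq ?enum_uniq // => t u /inj_map-/(_ val_inj).
  exact: val_inj.
move=> s; rewrite mem_filter r_mem; apply/mapP/andP => [[t] | [size_s Ps]].
  by rewrite mem_enum inE => Pt ->; rewrite size_map size_tuple.
have valK : map val (pmap (insub : nat -> option 'I_N) s) = s.
  rewrite pmap_filter; last exact: insubK.
  by apply/all_filterP/allP => x xs; rewrite isSome_insub (allP (bnd _ Ps)).
have size_t : size (pmap (insub : nat -> option 'I_N) s) == l.
  by rewrite -(size_map val) valK.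
by exists (Tuple size_t); rewrite ?mem_enum ?inE /= valK.
Qed.

Lemma num_kcompositionsE (k n l : nat) : 0 < k ->
  num_kcompositions k n.+1 l.+1%:Z
    = count (fun s => size s == l.+1) (kcomps k n).
Proof.
move=> k_gt0; apply: card_tuple_enum; first exact: kcomps_uniq.
  by move=> s; rewrite mem_kcomps.
exact: kcomposition_bound.
Qed.

(** Moving [j] across the equality avoids truncated subtraction. For [l <= j]
    the left side is 0 by convention, the right side because no k-composition
    is empty. *)
Lemma num_kcompositions_sub (k n l j : nat) : 0 < k ->
  num_kcompositions k n.+1 (l%:Z - j%:Z)%R
    = count (fun s => size s + j == l) (kcomps k n).
Proof.
move=> k_gt0; have [lj | jl] := leqP l j; last first.
  have -> : (l%:Z - j%:Z)%R = (l - j).-1.+1%:Z by lia.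
  by rewrite num_kcompositionsE //; apply: eq_count => s; lia.
rewrite (eq_in_count (a2 := pred0)); last first.
  by move=> [|x s] /head_kcomps-/(_ k_gt0) //= _; lia.
rewrite count_pred0.
have [-> | j_l] := eqVneq j l; first by rewrite subrr.
by have -> : (l%:Z - j%:Z)%R = Negz (j - l).-1 by lia.
Qed.

Lemma num_kcompositionsS (k n l : nat) : 0 < k ->
  num_kcompositions k n.+2 l.+1%:Z
    = \sum_(j < k.+1) num_kcompositions k n.+1 (l.+1%:Z - j%:Z)%R.
Proof.
move=> k_gt0; rewrite num_kcompositionsE //= count_cat big_ord_recl.
rewrite num_kcompositions_sub // count_map; congr (_ + _).
  apply: eq_in_count => s /head_kcomps-/(_ k_gt0) hd_s /=.
  by rewrite size_incr_nth addn0; case: s hd_s.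
rewrite count_flatten -map_comp sumnE big_map -{1}(subn0 k) big_mkord.
(* The block indexed by j adds j.+1 parts, whence the shift in the sum. *)
apply: eq_bigr => j _; rewrite num_kcompositions_sub //= count_map.
apply: eq_count => t /=.
by rewrite size_cat size_nseq addnS addnC.
Qed.

Lemma num_kcompositions1 (k l : nat) : 0 < k ->
  num_kcompositions k 1 l.+1%:Z = (l == 0).
Proof. by move=> k_gt0; rewrite num_kcompositionsE //=; case: l. Qed.

End KCompositions.

(** * Polynomial coefficients *)

Lemma polynomial_coefS (k n l : nat) :
  polynomial_coef k n.+1 l
    = \sum_(j < k.+1) if (l < j)%N then 0 else polynomial_coef k n (l - j).
Proof.
rewrite /polynomial_coef exprS mulr_suml coef_sum.
by apply: eq_bigr => j _; rewrite coefXnM.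
Qed.

Lemma num_kcompositions_coef (k n l : nat) : (0 < k)%N ->
  (num_kcompositions k n.+1 l.+1%:Z)%:Z = polynomial_coef k n l.
Proof.
move=> k_gt0; elim: n l => [|n IHn] l.
  by rewrite num_kcompositions1 // /polynomial_coef expr0 coef1; case: l.
rewrite num_kcompositionsS // polynomial_coefS (big_morph Posz PoszD (erefl 0%:Z)).
apply: eq_bigr => j _; case: ltnP => [lj | jl].
  have [-> | ] := eqVneq (j : nat) l.+1; first by rewrite subrr.
  by move=> j_l; have -> : l.+1%:Z - j%:Z = Negz (j - l.+1).-1 by lia.
by rewrite -IHn -subSn // -subzn // leqW.
Qed.

Theorem proposition4 (k : nat) (hk : (1 <= k)%N) :
  (forall n l : nat, (2 <= n)%N -> (1 <= l)%N ->
     num_kcompositions k n l%:Z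
       = (\sum_(j < k.+1) num_kcompositions k (n - 1) (l%:Z - j%:Z)%R)%N)
  /\
  (forall n l : nat, (1 <= n)%N -> (1 <= l)%N ->
     (num_kcompositions k n l%:Z)%:Z = polynomial_coef k (n - 1)%N (l - 1)%N).
Proof.
split=> [[|[|n]] [|l] // _ _ | [|n] [|l] // _ _].
  by rewrite subn1 num_kcompositionsS.
by rewrite !subn1 num_kcompositions_coef.
Qed.
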